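(* Let $X$ and $Y$ be pointed metric spaces. If $0<p<s<1$, then $$\Pi_{(p,\mathfrak{m}^L(p;p))}^{L}(X,Y)=\Pi_{(s,\mathfrak{m}^L(s;s))}^{L}(X,Y).$$
   Context: For a metric space $X$ with base point $x_0$, $X^{\#}$ is the Banach space of real-valued Lipschitz functions on $X$ vanishing at $x_0$, with norm $Lip(\cdot)$ (the Lipschitz constant); $B_{X^{\#}}$ is its closed unit ball. $(\sigma,x',x'')$ denotes a finite sequence $(\sigma_j,x'_j,x''_j)_{j=1}^m$ in $\mathbb{R}\times X\times X$. For $0<p<\infty$ put $\|(\sigma,x',x'')|\ell_p\|=\big[\sum_j|\sigma_j|^p d_X(x'_j,x''_j)^p\big]^{1/p}$ and $\|(\sigma,x',x'')|\ell_p^{L,w}\|=\sup_{f\in B_{X^{\#}}}\big[\sum_j|\sigma_j|^p|f(x'_j)-f(x''_j)|^p\big]^{1/p}$. For $0<p<\infty$, a Lipschitz map $T:X\to Y$ is Lipschitz $(p,\mathfrak{m}^L(p;p))$-summing if there is $C\ge0$ with $\|(\sigma,Tx',Tx'')|\ell_p\|\le C\,\|(\sigma,x',x'')|\ell_p^{L,w}\|$ for all finite sequences $(\sigma,x',x'')$ in $\mathbb{R}\times X\times X$, where $(\sigma,Tx',Tx'')=(\sigma_j,Tx'_j,Tx''_j)_j$. $\Pi^L_{(p,\mathfrak{m}^L(p;p))}(X,Y)$ is the class of all such maps. (This is the case $s=q=p$ of Lipschitz $(p,\mathfrak{m}^L(s;q))$-summing maps.) *)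

(* Defs.v *)
From mathcomp Require Import all_boot all_order all_algebra.
From mathcomp Require Import all_classical all_reals all_analysis.
Set Implicit Arguments.
Unset Strict Implicit.
Unset Printing Implicit Defensive.
Import Order.TTheory GRing.Theory Num.Theory.
Import numFieldNormedType.Exports.
Local Open Scope classical_set_scope.
Local Open Scope ring_scope.

(* A pointed metric space is a metricType together with an
   explicit base point. *)

Section LipschitzMaps.
Context {R : realType} {X Y : metricType R}.

Definition lip_constants (T : X -> Y) : set R :=
  [set K | 0 <= K /\ forall x y : X, mdist (T x) (T y) <= K * mdist x y].

Definition is_lipschitz (T : X -> Y) : Prop := lip_constants T !=set0.

(* Only meaningful when [is_lipschitz T], since [inf set0 = 0]. *)
Definition Lip (T : X -> Y) : R := inf (lip_constants T).

End LipschitzMaps.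

Section SummingMaps.
Context {R : realType}.

Lemma mdist_realE (a b : R^o) : mdist a b = `|a - b|.
Proof. exact: distrC. Qed.

(* X^#; R^o is R with its usual metric. *)
Definition lip_dual (X : metricType R) (x0 : X) : set (X -> R^o) :=
  [set f : X -> R^o | is_lipschitz f /\ f x0 = 0].

Definition lip_dual_ball (X : metricType R) (x0 : X) : set (X -> R^o) :=
  [set f : X -> R^o | lip_dual x0 f /\ Lip f <= 1].

(* A finite sequence (sigma, x', x'') is a list of triples
   t = (sigma_j, x'_j, x''_j), i.e. t.1.1 = sigma_j, t.1.2 = x'_j and
   t.2 = x''_j. *)
Definition lp_norm (X : metricType R) (p : R) (s : seq (R * X * X)) : R :=
  (\sum_(t <- s) `|t.1.1| `^ p * mdist t.1.2 t.2 `^ p) `^ p^-1.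

(* For 0 < p the set below contains 0 (take f = 0) and is bounded above by
   [lp_norm p s], so the real supremum is the genuine one. *)
Definition weak_lp_norm (X : metricType R) (x0 : X) (p : R)
    (s : seq (R * X * X)) : R :=
  sup [set (\sum_(t <- s) `|t.1.1| `^ p * `|f t.1.2 - f t.2| `^ p) `^ p^-1
      | f in lip_dual_ball x0].

Definition seq_image (X Y : metricType R) (T : X -> Y) (s : seq (R * X * X)) :
    seq (R * Y * Y) :=
  [seq (t.1.1, T t.1.2, T t.2) | t <- s].

(* The class Pi^L_(p, m^L(p;p))(X, Y). *)
Definition PiL (X Y : metricType R) (x0 : X) (p : R) : set (X -> Y) :=
  [set T | is_lipschitz T /\
    exists2 C : R, 0 <= C &
      forall s : seq (R * X * X),
        lp_norm p (seq_image T s) <= C * weak_lp_norm x0 p s].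

End SummingMaps.

Arguments PiL {R} X Y x0 p.

(* Main.v *)
Require Import Defs.
From mathcomp Require Import all_boot all_order all_algebra.
From mathcomp Require Import all_classical all_reals all_analysis.
From mathcomp Require Import ring lra.
Set Implicit Arguments.
Unset Strict Implicit.
Unset Printing Implicit Defensive.
Import Order.TTheory GRing.Theory Num.Theory.
Local Open Scope classical_set_scope.
Local Open Scope ring_scope.

(** Both inclusions rest on one observation: the coefficients of a summing
    inequality are arbitrary, so they may be chosen to suit the map. Written for
    [p]-th powers and weights [w_j >= 0], with [d_j = d(T x'_j, T x''_j)], the
    [p]-summing property says that [sum_j w_j d_j^p <= C D] as soon as
    [sum_j w_j |f x'_j - f x''_j|^p <= D] for every nonexpansive [f]
    ([summing], [PiLP]).

    To pass from [p] to [s > p], use the weights [w_j d_j^(s-p)] and absorb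
    ([summing_le]).

    To pass from [s] to [p < s], let [D] bound the [p]-sums of nonexpansive
    functions, and suppose first that some [f] maximises
    [G f = sum_j w_j |f x'_j - f x''_j|^p]. Let [g] be nonexpansive. Since
    [f + r g] is [1 + |r|] times a nonexpansive function,
    [G (f + r g) - G f <= ((1 + |r|)^p - 1) G f]. Integrate this against the
    Levy measure [dr / |r|^(1+s)] of a symmetric [s]-stable law. The right-hand
    side converges because [p < s < 1] and gives a multiple of [D]. On the left,
    the integral of [|a + r b|^p - |a|^p] is by homogeneity a multiple of
    [|a|^(p-s) |b|^s], with a positive factor when [p < s]. Hence, with
    [a_j = |f x'_j - f x''_j|],

      [sum_j w_j a_j^(p-s) |g x'_j - g x''_j|^s <= K D] for all nonexpansive [g].

    The [s]-summing property for the weights [w_j a_j^(p-s)] now gives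
    [sum_j w_j a_j^(p-s) d_j^s <= C K D], and
    [d_j^p <= a_j^(p-s) d_j^s + a_j^p] finishes the argument. It is a maximality
    version of Maurey's use of stable laws, and works for nonlinear maps because
    only the functions [f] and [g] are combined linearly.

    In the formal argument a near-maximiser replaces the maximiser, [a_j] is
    replaced by [max(a_j, eta)] to keep the weights finite, and the integral by a
    finite sum over [r = 2^-k] and [r = - 2^-k] ([truncated_weights_le]). The
    discrete sum has the right sign when [s - p] is small ([dyadic_gain_ge],
    [summing_of_close]); a general pair [p < s] is joined by finitely many such
    steps ([summing_ge]). *)

(** * Real inequalities *)

Section RealInequalities.
Context {R : realType}.
Implicit Types (p s x y a b eta u : R) (n : nat).

Lemma ler_powRl p x y : 0 <= p -> 0 <= x -> x <= y -> x `^ p <= y `^ p.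
Proof.
move=> p0 x0 xy; apply: ge0_ler_powR => //; rewrite nnegrE //.
exact: le_trans xy.
Qed.

Lemma powRKV p (x : R) : 0 < p -> 0 <= x -> (x `^ p^-1) `^ p = x.
Proof. by move=> p0 x0; rewrite -powRrM mulVf ?powRr1 // gt_eqF. Qed.

Lemma powRVK p (x : R) : 0 < p -> 0 <= x -> (x `^ p) `^ p^-1 = x.
Proof. by move=> p0 x0; rewrite -powRrM mulfV ?powRr1 // gt_eqF. Qed.

(** A form of Young's inequality that needs no conjugate exponents: [x^(s-p) y^p]
    is bounded by the first term alone if [y <= delta x] and by the second alone
    otherwise. *)
Lemma weighted_young p s (delta x y : R) : 0 < p -> p < s -> 0 < delta ->
  0 <= x -> 0 <= y ->
  x `^ (s - p) * y `^ p <= delta `^ p * x `^ s + delta `^ (p - s) * y `^ s.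
Proof.
move=> p0 ps dl0 x0 y0.
have split_pow (z : R) : z `^ s = z `^ (s - p) * z `^ p.
  by rewrite -powRD subrK // gt_eqF // (lt_trans p0).
have [yx|xy] := leP y (delta * x).
  apply: le_trans (_ : delta `^ p * x `^ s <= _); last first.
    by rewrite lerDl mulr_ge0 ?powR_ge0.
  rewrite split_pow mulrCA; apply: ler_wpM2l; first exact: powR_ge0.
  by rewrite -powRM // ?(ltW dl0) //; apply: ler_powRl => //; exact: ltW.
apply: le_trans (_ : delta `^ (p - s) * y `^ s <= _); last first.
  by rewrite lerDr mulr_ge0 ?powR_ge0.
rewrite split_pow mulrA; apply: ler_wpM2r; first exact: powR_ge0.
rewrite -[p - s]opprB powRN mulrC ler_pdivlMr ?powR_gt0 //.
rewrite -powRM ?(ltW dl0) // mulrC.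
by apply: ler_powRl (ltW xy); rewrite ?subr_ge0 ?mulr_ge0 // ltW.
Qed.

(** The power [|a|^p] with [|a|] replaced by [max(|a|, eta)]: bounded below away
    from [0], so that [max(|a|, eta)^(p-s)] makes sense as a weight, and still
    growing at most by the factor [r^p] when [a] is multiplied by [r >= 1]. *)
Definition trunc_pow p eta a : R := Num.max `|a| eta `^ p.

(** A lower bound for [|1 + x|^p + |1 - x|^p - 2] when [x >= 0] and
    [0 < p <= 1]. *)
Definition gain p x : R := Num.max (- x) (x `^ p - 2).

(** Of the two numbers [a + b] and [a - b], one has absolute value [|a| + |b|] and
    the other at least [|a| - |b|]. Keeping only the first gives the bound
    [x^p - 2] with [x = |b| / A], where [A = max(|a|, eta)]; keeping both, and
    [(1 - x)^p >= 1 - x], gives the bound [- x]. *)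
Lemma trunc_pow_second_diff p eta a b : 0 < p -> p <= 1 -> 0 < eta ->
  Num.max `|a| eta `^ p * gain p (`|b| / Num.max `|a| eta) <=
    trunc_pow p eta (a + b) + trunc_pow p eta (a - b) - 2 * trunc_pow p eta a.
Proof.
move=> p0 p1 eta0; set A : R := Num.max `|a| eta.
have A0 : 0 < A by rewrite /A lt_max eta0 orbT.
have AE : trunc_pow p eta a = A `^ p by [].
have key c d : `|a| + `|b| <= `|c| -> `|a| - `|b| <= `|d| ->
    A `^ p * gain p (`|b| / A) <=
    trunc_pow p eta c + trunc_pow p eta d - 2 * trunc_pow p eta a.
  move=> hc hd; rewrite AE.
  have b0 := normr_ge0 b; have a0 := normr_ge0 a.
  have v0 : 0 <= `|b| / A by rewrite divr_ge0 // ltW.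
  have bE : `|b| = `|b| / A * A by rewrite divfK // gt_eqF.
  have Ap0 := powR_ge0 A p.
  have d0 : 0 <= trunc_pow p eta d := powR_ge0 _ _.
  have c1 : A `^ p <= trunc_pow p eta c.
    apply: ler_powRl; [exact: ltW|exact: ltW|].
    by rewrite ge_max !le_max lexx orbT andbT; apply/orP; left; lra.
  have c2 : A `^ p * (`|b| / A) `^ p <= trunc_pow p eta c.
    rewrite -powRM ?(ltW A0) // [A * _]mulrC -bE.
    apply: ler_powRl; [exact: ltW|by []|].
    by rewrite le_max; apply/orP; left; lra.
  have d1 : A `^ p * (1 - `|b| / A) <= trunc_pow p eta d.
    have [v1|v1] := leP (`|b| / A) 1; last first.
      by apply: le_trans d0; rewrite mulr_ge0_le0 // subr_le0 ltW.
    have h : A * (1 - `|b| / A) <= Num.max `|d| eta.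
      rewrite mulrBr mulr1 [A * _]mulrC -bE lerBlDr /A ge_max.
      rewrite -!lerBlDr !le_max; apply/andP; split; apply/orP; first by left.
      by right; lra.
    have h1 : A `^ p * (1 - `|b| / A) `^ p <= trunc_pow p eta d.
      have w0 : 0 <= 1 - `|b| / A by rewrite subr_ge0.
      rewrite -(powRM _ (ltW A0) w0).
      by apply: ler_powRl => //; [exact: ltW|rewrite mulr_ge0 // ltW].
    apply: le_trans h1; apply: ler_wpM2l => //.
    have [->|v1'] := eqVneq (`|b| / A) 1; first by rewrite subrr powR_ge0.
    by apply: ger1_powR => //; rewrite subr_gt0 lt_neqAle v1' v1 /= gerBl.
  rewrite /gain; case: (leP (- _)) => _; last lra.
  have := mulr_ge0 Ap0 (powR_ge0 (`|b| / A) p); lra.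
have [a0|a0] := leP 0 a; have [b0|b0] := leP 0 b.
- apply: key; first by rewrite !ger0_norm ?addr_ge0.
  by have := lerB_normD a (- b); rewrite normrN.
- rewrite [trunc_pow _ _ (a + b) + _]addrC; apply: key; last exact: lerB_normD.
  by rewrite ger0_norm // ltr0_norm // ger0_norm; lra.
- rewrite [trunc_pow _ _ (a + b) + _]addrC; apply: key; last exact: lerB_normD.
  by rewrite (ger0_norm b0) !ltr0_norm //; lra.
- apply: key; first by rewrite !ltr0_norm //; lra.
  by have := lerB_normD a (- b); rewrite normrN.
Qed.

(** A discrete version, with steps [t = 2^-k], of the integral of [gain p (t u)]
    against the Levy measure [dt / t^(1+s)] of an [s]-stable law. *)
Definition dyadic_gain p s n u : R :=
  \sum_(k < n.+1) (2 `^ s) ^+ k * gain p (u / 2 ^+ k).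

Lemma dyadic_gain0 p s u : dyadic_gain p s 0 u = gain p u.
Proof. by rewrite /dyadic_gain big_ord_recl big_ord0 /= !expr0 mul1r divr1 addr0. Qed.

Lemma dyadic_gainS p s n u :
  dyadic_gain p s n.+1 u = gain p u + 2 `^ s * dyadic_gain p s n (u / 2).
Proof.
rewrite /dyadic_gain big_ord_recl /= !expr0 mul1r divr1; congr (_ + _).
rewrite mulr_sumr; apply: eq_bigr => k _.
by rewrite /bump /= add1n !exprS mulrA invfM mulrA.
Qed.

Let powR1E s : 1 `^ s = 1 :> R. Proof. by rewrite powR1. Qed.

Lemma powR2_lt s : s < 1 -> 2 `^ s < 2 :> R.
Proof.
move=> s1; have l0 : 0 < ln (2 : R) by rewrite ln_gt0 // ltr1n.
rewrite -[ltRHS](@powRr1 R) // /powR pnatr_eq0 /= ltr_expR.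
by rewrite ltr_pM2r.
Qed.

Lemma powR2_gt1 s : 0 < s -> 1 < 2 `^ s :> R.
Proof.
move=> s0; rewrite -[ltLHS](powR1E s); apply: gt0_ltr_powR => //.
- by rewrite nnegrE ler01.
- by rewrite nnegrE ler0n.
- exact: ltr1n.
Qed.

(** As [p] tends to [s] the right-hand side tends to infinity, so this holds when
    [s - p] is small enough compared with [s] and [1 - s]. *)
Definition close_exponents p s :=
  3 + 2 / (2 `^ s - 1) + 4 / (2 - 2 `^ s) <= (2 `^ (s - p) - 1)^-1.

(** The sum over dyadic steps behaves like [u^s]. With [a = 2^s], the recursion
    [F (n+1) u = gain u + a F n (u/2)] has, where [gain u >= u^p - 2], the exact
    subsolution [u^s - be u^p + ga] with [be = 1 / (2^(s-p) - 1)] and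
    [ga = 2 / (a - 1)]; for [u <= 1], where [gain u >= - u], it has the
    subsolution [- ka u] with [ka = 2 / (2 - a)], which is where [s < 1] enters.
    The closeness of the exponents makes the two fit together on [(1, 2]]. The
    hypothesis [u <= 2^n] says that the steps go down far enough for [u / 2^n]
    to lie in the second regime. *)
Lemma dyadic_gain_ge p s n u :
  0 < p -> p < s -> s < 1 -> close_exponents p s ->
  0 <= u -> u <= 2 ^+ n ->
  u `^ s - (2 `^ (s - p) - 1)^-1 * u `^ p - (1 + 2 / (2 - 2 `^ s)) <=
    dyadic_gain p s n u.
Proof.
move=> p0 ps s1; rewrite /close_exponents.
have sp1 : 1 < 2 `^ (s - p) :> R by apply: powR2_gt1; rewrite subr_gt0.
have a1 : 1 < 2 `^ s :> R by apply: powR2_gt1; exact: lt_trans ps.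
have a2 := powR2_lt s1.
have ae : 2 `^ s / 2 `^ p = 2 `^ (s - p) :> R.
  by rewrite powRB // pnatr_eq0 implybT.
have b0 : 0 < 2 `^ p :> R by apply: powR_gt0; rewrite ltr0n.
set a := 2 `^ s in a1 a2 ae *; set be := (2 `^ (s - p) - 1)^-1.
set ga := 2 / (a - 1); set ka := 2 / (2 - a) => hbe.
have e4 : 4 / (2 - a) = 2 * ka by rewrite /ka mulrA -natrM.
have {}hbe : 3 + ga + 2 * ka <= be by rewrite -e4.
have ga0 : 0 < ga by rewrite /ga divr_gt0 ?subr_gt0 ?ltr0n.
have ka0 : 0 < ka by rewrite /ka divr_gt0 ?subr_gt0 ?ltr0n.
have gaE : a * ga = ga + 2 by rewrite /ga; field; rewrite subr_eq0 gt_eqF.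
have kaE : a * ka = 2 * ka - 2 by rewrite /ka; field; rewrite subr_eq0 gt_eqF.
have beE : a / 2 `^ p * be = be + 1.
  by rewrite ae /be; field; rewrite subr_eq0 gt_eqF.
have small m v : 0 <= v -> v <= 1 -> - (ka * v) <= dyadic_gain p s m v.
  elim: m v => [|m IH] v v0 v1.
    rewrite dyadic_gain0 /gain le_max; apply/orP; left.
    rewrite lerN2 ler_peMl // /ka ler_pdivlMr ?subr_gt0 //; lra.
  rewrite dyadic_gainS -/a.
  have h : - v <= gain p v by rewrite /gain le_max lexx.
  have := IH (v / 2); rewrite divr_ge0 // => /(_ isT) h2.
  have {}h2 : - (ka * (v / 2)) <= dyadic_gain p s m (v / 2) by apply: h2; lra.
  have := ler_wpM2l (ltW (lt_trans ltr01 a1)) h2.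
  have -> : a * - (ka * (v / 2)) = - (a * ka) * v / 2 by ring.
  rewrite kaE; lra.
have large m v : 1 < v -> v <= 2 ^+ m ->
    v `^ s - be * v `^ p + ga <= dyadic_gain p s m v.
  elim: m v => [|m IH] v v1 vm; first by move: vm; rewrite expr0; lra.
  rewrite dyadic_gainS -/a.
  have h : v `^ p - 2 <= gain p v by rewrite /gain le_max lexx orbT.
  have [v2|v2] := leP (v / 2) 1.
    have := small m (v / 2); rewrite divr_ge0 ?(ltW (lt_trans ltr01 v1)) //.
    move=> /(_ isT v2) /(ler_wpM2l (ltW (lt_trans ltr01 a1))).
    have -> : a * - (ka * (v / 2)) = - (a * ka) * (v / 2) by ring.
    have vs : v `^ s <= a by apply: ler_powRl; lra.
    have vp : 1 <= v `^ p by rewrite -[leLHS](powRr0 v); apply: ler_powR; exact: ltW.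
    have : be <= be * v `^ p by rewrite ler_peMr //; lra.
    have : a * ka * (v / 2) <= a * ka by rewrite ler_piMr // mulr_ge0 //; lra.
    rewrite kaE; lra.
  have vv : v / 2 <= 2 ^+ m by move: vm; rewrite exprS; lra.
  have := IH _ v2 vv => /(ler_wpM2l (ltW (lt_trans ltr01 a1))).
  have v0 : 0 <= v by lra.
  rewrite !powRM // ?invr_ge0 // -!powR_inv1 // -![(2 `^ -1) `^ _]powRrM.
  rewrite !mulN1r !powRN -/a.
  have -> : a * (v `^ s / a - be * (v `^ p / 2 `^ p) + ga) =
      v `^ s - a / 2 `^ p * be * v `^ p + a * ga.
    by field; rewrite !gt_eqF // (lt_trans ltr01).
  rewrite beE gaE; lra.
move=> u0 un; have [u1|u1] := leP u 1.
  have us : u `^ s <= 1.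
    rewrite -[leRHS](powR1E s); apply: ler_powRl => //; exact: ltW (lt_trans p0 ps).
  have := small n u u0 u1; have : ka * u <= ka by rewrite ler_piMr // ltW.
  have : 0 <= be * u `^ p by rewrite mulr_ge0 ?powR_ge0 //; lra.
  lra.
have := large n u u1 un; lra.
Qed.

Lemma geometric_sum_le (q : R) n : 0 <= q -> q < 1 ->
  \sum_(k < n) q ^+ k <= (1 - q)^-1.
Proof.
move=> q0 q1; rewrite -[leRHS]mul1r ler_pdivlMr ?subr_gt0 // mulrC.
have := subrX1 q n; have := exprn_ge0 n q0.
set S := \sum_(k < n) _ => h1 h2; lra.
Qed.

(** Here [S] is a supremum, [w] a value within [x] of it, and [u], [v] the values
    after a perturbation of size [r] in two opposite directions. *)
Lemma second_diff_le (u v w S r x y : R) :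
  2 * x = y -> u <= (1 + r) * S -> v <= (1 + r) * S -> S - x <= w ->
  u + v - 2 * w <= 2 * S * r + y.
Proof. lra. Qed.

End RealInequalities.

(** * Summing maps in terms of weights *)

Section Reformulation.
Context {R : realType} {X Y : metricType R}.
Implicit Types (p : R) (f : X -> R) (T : X -> Y) (l : seq (R * X * X)).

Definition nonexpansive f := forall x y, `|f x - f y| <= mdist x y.

(** The summing property with the [p]-th powers taken, the coefficients
    [|sigma_j|^p] read as arbitrary weights, and the supremum over the unit ball
    replaced by a variable bound [D]; in this form test functions need not vanish
    at the base point. Arbitrary weights are what lets one change the exponent. *)
Definition summing p T := exists2 C : R, 0 <= C &
  forall l (D : R),
    (forall f, nonexpansive f ->
       \sum_(t <- l) `|t.1.1| * `|f t.1.2 - f t.2| `^ p <= D) ->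
    \sum_(t <- l) `|t.1.1| * mdist (T t.1.2) (T t.2) `^ p <= C * D.

Lemma nonexpansive0 : nonexpansive (fun=> 0).
Proof. by move=> x y; rewrite subrr normr0 mdist_ge0. Qed.

(** The infimum of the Lipschitz constants is attained, so [Lip f <= 1] means that
    [f] is nonexpansive. *)
Lemma lip_dual_ballP (x0 : X) f :
  lip_dual_ball x0 f <-> nonexpansive f /\ f x0 = 0.
Proof.
split=> [[[lf f0] lip1]|[nf f0]].
  split=> // x y; apply/ler_addgt0Pr => e e0.
  have hi : has_inf (@lip_constants R X R^o f).
    by split=> //; exists 0 => K [].
  have d0 := mdist_ge0 x y.
  have d1 : 0 < mdist x y + 1 by rewrite ltr_wpDl.
  have [K [K0 hK] Klt] := inf_adherent (divr_gt0 e0 d1) hi.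
  have {}Klt : K <= 1 + e / (mdist x y + 1).
    by apply: le_trans (ltW Klt) _; rewrite lerD2r.
  have := hK x y; rewrite mdist_realE => /le_trans; apply.
  apply: (le_trans (ler_wpM2r d0 Klt)); rewrite mulrDl mul1r lerD2l.
  rewrite -mulrA ger_pMr // mulrC ler_pdivrMr // mul1r lerDl //.
have h1 : @lip_constants R X R^o f 1.
  by split=> // x y; rewrite mdist_realE mul1r; exact: nf.
split; first by split=> //; exists 1.
by apply: ge_inf h1; exists 0 => K [].
Qed.

Lemma sum_powR_ge0 p f l :
  0 <= \sum_(t <- l) `|t.1.1| * `|f t.1.2 - f t.2| `^ p.
Proof. by apply: sumr_ge0 => t _; rewrite mulr_ge0 ?powR_ge0. Qed.

(** Each weight [w >= 0] is [|sigma|^p] for [sigma = w^(1/p)], and subtracting the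
    constant [f x0] from a nonexpansive [f] puts it in the unit ball without
    changing its differences. *)
Lemma PiLP (x0 : X) p T : 0 < p ->
  PiL X Y x0 p T <-> is_lipschitz T /\ summing p T.
Proof.
move=> p0; have pV0 : 0 <= p^-1 by rewrite invr_ge0 ltW.
split=> -[lipT [C C0 hC]]; split=> //.
  exists (C `^ p); first exact: powR_ge0.
  move=> l D hD.
  have D0 : 0 <= D := le_trans (sum_powR_ge0 p _ l) (hD _ nonexpansive0).
  pose sq := [seq (`|t.1.1| `^ p^-1, t.1.2, t.2) | t <- l].
  have sE (t : R * X * X) : `| `|t.1.1| `^ p^-1| `^ p = `|t.1.1|.
    by rewrite ger0_norm ?powR_ge0 // powRKV.
  have wle : weak_lp_norm x0 p sq <= D `^ p^-1.
    apply: ge_sup.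
      exists ((\sum_(t <- sq) `|t.1.1| `^ p * `|(0:R) - 0| `^ p) `^ p^-1).
      by exists (fun=> 0) => //; apply/lip_dual_ballP; split=> //; exact: nonexpansive0.
    move=> _ [f /lip_dual_ballP[nf _] <-]; apply: ler_powRl => //.
      by apply: sumr_ge0 => t _; rewrite mulr_ge0 ?powR_ge0.
    rewrite big_map; under eq_bigr do rewrite /= sE; exact: hD.
  have := le_trans (hC sq) (ler_wpM2l C0 wle).
  rewrite /lp_norm /seq_image !big_map.
  under eq_bigr do rewrite /= sE.
  set S := \sum_(t <- l) _ => h.
  have S0 : 0 <= S by apply: sumr_ge0 => t _; rewrite mulr_ge0 ?powR_ge0.
  have := ler_powRl (ltW p0) (powR_ge0 _ _) h.
  by rewrite powRM ?powR_ge0 // !powRKV.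
exists (C `^ p^-1); first exact: powR_ge0.
move=> sq; set W := weak_lp_norm x0 p sq.
pose l := [seq (`|t.1.1| `^ p, t.1.2, t.2) | t <- sq].
have sE (t : R * X * X) : `| `|t.1.1| `^ p| = `|t.1.1| `^ p.
  by rewrite ger0_norm ?powR_ge0.
have mem f : nonexpansive f -> f x0 = 0 ->
    (\sum_(t <- sq) `|t.1.1| `^ p * `|f t.1.2 - f t.2| `^ p) `^ p^-1 <= W.
  move=> nf f0; apply: ub_le_sup; last first.
    by exists f => //; apply/lip_dual_ballP.
  exists (lp_norm p sq) => _ [g /lip_dual_ballP[ng _] <-].
  apply: ler_powRl => //.
    by apply: sumr_ge0 => t _; rewrite mulr_ge0 ?powR_ge0.
  apply: ler_sum => t _; rewrite ler_wpM2l ?powR_ge0 //.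
  exact: ler_powRl (ltW p0) (normr_ge0 _) (ng _ _).
have W0 : 0 <= W := le_trans (powR_ge0 _ _) (mem _ nonexpansive0 erefl).
have := hC l (W `^ p); rewrite !big_map.
under eq_bigr do rewrite /= sE.
rewrite /lp_norm /seq_image big_map /= => H.
rewrite -{1}(powRVK p0 W0) -powRM ?powR_ge0 //; apply: ler_powRl => //.
  by apply: sumr_ge0 => t _; rewrite mulr_ge0 ?powR_ge0.
apply: H => f nf; rewrite big_map; under eq_bigr do rewrite /= sE.
have nf' : nonexpansive (fun x => f x - f x0).
  by move=> x y; rewrite /= opprB addrA subrK.
set S := \sum_(t <- sq) _.
have h : S `^ p^-1 <= W.
  apply: le_trans (mem _ nf' (subrr _)).
  by under [in leRHS]eq_bigr do rewrite /= opprB addrA subrK.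
have S0 : 0 <= S by apply: sumr_ge0 => t _; rewrite mulr_ge0 ?powR_ge0.
by have := ler_powRl (ltW p0) (powR_ge0 _ _) h; rewrite powRKV.
Qed.

(** Put [d_j = d(T x'_j, T x''_j)] and apply the [p]-summing property with weights
    [w_j d_j^(s-p)]: the left-hand side becomes [S = sum_j w_j d_j^s], and by
    [weighted_young] the right-hand side is a small multiple of [S], which is
    absorbed, plus a multiple of [D]. *)
Lemma summing_le p s T : 0 < p -> p < s -> summing p T -> summing s T.
Proof.
move=> p0 ps [C C0 hC].
have c0 : 0 < 2 * (C + 1) by rewrite mulr_gt0 // ltr_wpDl.
(* With this choice [C * delta^p <= 1/2]. *)
pose delta := ((2 * (C + 1))^-1) `^ p^-1.
have dl0 : 0 < delta by rewrite powR_gt0 // invr_gt0.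
have dlp : delta `^ p = (2 * (C + 1))^-1 by rewrite powRKV // invr_ge0 ltW.
exists (2 * C * delta `^ (p - s)); first by rewrite !mulr_ge0 // powR_ge0.
move=> l D hD; set S := \sum_(t <- l) _.
have S0 : 0 <= S by apply: sumr_ge0 => t _; rewrite mulr_ge0 ?powR_ge0.
pose l' := [seq (`|t.1.1| * mdist (T t.1.2) (T t.2) `^ (s - p), t.1.2, t.2) | t <- l].
have wE (t : R * X * X) : `| `|t.1.1| * mdist (T t.1.2) (T t.2) `^ (s - p)| =
    `|t.1.1| * mdist (T t.1.2) (T t.2) `^ (s - p).
  by rewrite ger0_norm // mulr_ge0 ?powR_ge0.
have := hC l' (delta `^ p * S + delta `^ (p - s) * D); rewrite big_map /=.
under eq_bigr => t _ do
  rewrite wE -mulrA -powRD ?subrK ?(gt_eqF (lt_trans p0 ps)) //.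
rewrite -/S => H.
have {}H : S <= C * (delta `^ p * S + delta `^ (p - s) * D).
  apply: H => f nf; rewrite big_map /=.
  apply: le_trans (lerD (lexx _) (ler_wpM2l (powR_ge0 _ _) (hD f nf))).
  rewrite !mulr_sumr -big_split /=; apply: ler_sum => t _; rewrite wE -mulrA.
  have := weighted_young p0 ps dl0 (mdist_ge0 (T t.1.2) (T t.2))
    (normr_ge0 (f t.1.2 - f t.2)).
  move=> /(ler_wpM2l (normr_ge0 t.1.1)) /le_trans; apply.
  by rewrite mulrDr mulrCA [X in _ + X]mulrCA.
have : C * delta `^ p <= 2^-1.
  by rewrite dlp ler_pdivrMr // mulrA mulVf ?mul1r ?lerDl // pnatr_eq0.
move=> /(ler_wpM2r S0); move: H; rewrite mulrDr !mulrA; lra.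
Qed.

End Reformulation.

(** * Perturbing a near-maximiser *)

Section Perturbation.
Context {R : realType} {X : metricType R}.
Implicit Types (p s eta : R) (f g : X -> R) (l : seq (R * X * X)).

Definition trunc_sum p eta l f : R :=
  \sum_(t <- l) `|t.1.1| * trunc_pow p eta (f t.1.2 - f t.2).

Lemma trunc_pow_le p eta (a : R) : 0 < eta ->
  trunc_pow p eta a <= `|a| `^ p + eta `^ p.
Proof.
move=> eta0; rewrite /trunc_pow; case: (leP `|a|) => _.
  by rewrite lerDr powR_ge0.
by rewrite lerDl powR_ge0.
Qed.

Lemma trunc_sum_ge0 p eta l f : 0 <= trunc_sum p eta l f.
Proof. by apply: sumr_ge0 => t _; rewrite mulr_ge0 // powR_ge0. Qed.

Lemma trunc_sum_scale p eta l f (r : R) : 0 <= p -> p <= 1 -> 0 < eta -> 1 <= r ->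
  trunc_sum p eta l (fun x => r * f x) <= r * trunc_sum p eta l f.
Proof.
move=> p0 p1 eta0 r1; have r0 : 0 <= r := le_trans ler01 r1.
rewrite mulr_sumr; apply: ler_sum => t _.
rewrite [leRHS]mulrCA; apply: ler_wpM2l => //.
rewrite /= -mulrBr /trunc_pow normrM (ger0_norm r0).
have m0 : 0 <= Num.max `|f t.1.2 - f t.2| eta by rewrite le_max normr_ge0.
apply: le_trans (_ : (r * Num.max `|f t.1.2 - f t.2| eta) `^ p <= _).
  apply: ler_powRl => //; first by rewrite le_max mulr_ge0.
  rewrite ge_max; apply/andP; split.
    by apply: ler_wpM2l => //; rewrite le_max lexx.
  apply: le_trans (_ : 1 * eta <= _); first by rewrite mul1r.
  by apply: ler_pM => //; [exact: ltW|rewrite le_max lexx orbT].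
rewrite powRM //; apply: ler_wpM2r; first exact: powR_ge0.
exact: ler1_powR.
Qed.

(** [f + r g] is [1 + r] times a nonexpansive function, and [(1 + r)^p <= 1 + r]. *)
Lemma trunc_sum_perturb p eta l f g (S r : R) :
  0 <= p -> p <= 1 -> 0 < eta -> 0 <= r ->
  (forall h, nonexpansive h -> trunc_sum p eta l h <= S) ->
  nonexpansive f -> nonexpansive g ->
  trunc_sum p eta l (fun x => f x + r * g x) <= (1 + r) * S.
Proof.
move=> p0 p1 eta0 r0 hS nf ng; have r1 : 0 < 1 + r by rewrite ltr_wpDr.
pose h x := (1 + r)^-1 * (f x + r * g x).
have -> : (fun x => f x + r * g x) = (fun x => (1 + r) * h x).
  by apply/funext => x; rewrite /h mulVKf // gt_eqF.
apply: le_trans (trunc_sum_scale _ _ p0 p1 eta0 _) _; first by rewrite lerDl.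
apply: ler_wpM2l; first exact: ltW.
apply: hS => x y; rewrite /h -mulrBr normrM gtr0_norm ?invr_gt0 //.
rewrite mulrC ler_pdivrMr // mulrDr mulr1.
have -> : f x + r * g x - (f y + r * g y) = (f x - f y) + r * (g x - g y) by ring.
apply: le_trans (ler_normD _ _) _; apply: lerD; first exact: nf.
by rewrite normrM (ger0_norm r0) mulrC; apply: ler_wpM2r => //; exact: ng.
Qed.

(** Sums [trunc_pow_second_diff] over the pairs of points and over the dyadic
    steps, then applies [dyadic_gain_ge] to each pair with [u = |b| / A], where
    [A = max(|a|, eta)] and [a], [b] are the differences of [f] and [g]. The
    three terms [u^s], [u^p] and [1] multiplied by [A^p] give [A^(p-s) |b|^s],
    [|b|^p] and [A^p]. *)
Lemma dyadic_second_diff p s eta l f g n :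
  0 < p -> p < s -> s < 1 -> close_exponents p s -> 0 < eta ->
  (forall t, t \in l -> `|g t.1.2 - g t.2| <= 2 ^+ n * eta) ->
  \sum_(t <- l) `|t.1.1| * Num.max `|f t.1.2 - f t.2| eta `^ (p - s) * `|g t.1.2 - g t.2| `^ s
  <= (2 `^ (s - p) - 1)^-1 * \sum_(t <- l) `|t.1.1| * `|g t.1.2 - g t.2| `^ p
   + (1 + 2 / (2 - 2 `^ s)) * trunc_sum p eta l f
   + \sum_(k < n.+1) (2 `^ s) ^+ k *
       (trunc_sum p eta l (fun x => f x + (2 ^+ k)^-1 * g x)
        + trunc_sum p eta l (fun x => f x + (2 ^+ k)^-1 * - g x)
        - 2 * trunc_sum p eta l f).
Proof.
move=> p0 ps s1 close eta0 hn.
pose A (t : R * X * X) : R := Num.max `|f t.1.2 - f t.2| eta.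
have p1 : p <= 1 := ltW (lt_trans ps s1).
have A0 t : 0 < A t by rewrite /A lt_max eta0 orbT.
set be := (2 `^ (s - p) - 1)^-1; set ka := 2 / (2 - 2 `^ s).
apply: le_trans (_ : be * (\sum_(t <- l) `|t.1.1| * `|g t.1.2 - g t.2| `^ p)
   + (1 + ka) * trunc_sum p eta l f
   + \sum_(t <- l) `|t.1.1| * A t `^ p *
       dyadic_gain p s n (`|g t.1.2 - g t.2| / A t) <= _).
  rewrite /trunc_sum !mulr_sumr -!big_split /= big_seq [leRHS]big_seq.
  apply: ler_sum => t /hn; rewrite -/(A t); set b := `|_| => bn.
  have b0 : 0 <= b by rewrite normr_ge0.
  have u0 : 0 <= b / A t by rewrite divr_ge0 // ltW.
  have un : b / A t <= 2 ^+ n.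
    rewrite ler_pdivrMr //; apply: le_trans bn _.
    by rewrite ler_wpM2l ?exprn_ge0 // /A le_max lexx orbT.
  have /(ler_wpM2l (mulr_ge0 (normr_ge0 t.1.1) (powR_ge0 (A t) p))) :=
    dyadic_gain_ge p0 ps s1 close u0 un.
  rewrite -/be -/ka !powRM ?invr_ge0 ?(ltW (A0 t)) //.
  rewrite -!powR_inv1 ?(ltW (A0 t)) // -!powRrM !mulN1r !powRN.
  have -> : A t `^ (p - s) = A t `^ p / A t `^ s.
    by rewrite powRB // (gt_eqF (A0 t)) implybT.
  have -> : trunc_pow p eta (f t.1.2 - f t.2) = A t `^ p by [].
  have -> : `|t.1.1| * A t `^ p *
      (b `^ s / A t `^ s - be * (b `^ p / A t `^ p) - (1 + ka)) =
    `|t.1.1| * (A t `^ p / A t `^ s) * b `^ s - be * (`|t.1.1| * b `^ p)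
     - (1 + ka) * (`|t.1.1| * A t `^ p).
    by field; rewrite !gt_eqF // powR_gt0.
  lra.
rewrite lerD2l.
under eq_bigr do rewrite /dyadic_gain mulr_sumr.
rewrite exchange_big /=; apply: ler_sum => k _.
rewrite /trunc_sum mulr_sumr -big_split /= -sumrB mulr_sumr.
apply: ler_sum => t _.
rewrite mulrCA; apply: ler_wpM2l; first by rewrite exprn_ge0 // powR_ge0.
have k0 : 0 <= (2 ^+ k)^-1 :> R by rewrite invr_ge0 exprn_ge0.
have := trunc_pow_second_diff (f t.1.2 - f t.2)
  ((2 ^+ k)^-1 * (g t.1.2 - g t.2)) p0 p1 eta0.
move=> /(ler_wpM2l (normr_ge0 t.1.1)).
rewrite normrM (ger0_norm k0) -/(A t) mulrA.
have -> : (2 ^+ k)^-1 * `|g t.1.2 - g t.2| / A t =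
   `|g t.1.2 - g t.2| / A t / 2 ^+ k by rewrite [_ * `|_|]mulrC mulrAC.
move=> /le_trans; apply.
have -> : f t.1.2 + (2 ^+ k)^-1 * g t.1.2 - (f t.2 + (2 ^+ k)^-1 * g t.2) =
  f t.1.2 - f t.2 + (2 ^+ k)^-1 * (g t.1.2 - g t.2) by ring.
have -> : f t.1.2 + (2 ^+ k)^-1 * - g t.1.2 - (f t.2 + (2 ^+ k)^-1 * - g t.2) =
  f t.1.2 - f t.2 - (2 ^+ k)^-1 * (g t.1.2 - g t.2) by ring.
by rewrite mulrBr mulrDr [_ * (2 * _)]mulrCA mulrA.
Qed.

End Perturbation.

(** * Lowering the exponent *)

Section Extrapolation.
Context {R : realType} {X Y : metricType R}.
Implicit Types (p s : R) (T : X -> Y) (l : seq (R * X * X)).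

Lemma near_maximizer p eta l (D eps : R) :
  (forall f : X -> R, nonexpansive f -> trunc_sum p eta l f <= D) -> 0 < eps ->
  exists S : R, exists2 f : X -> R, nonexpansive f &
    [/\ S <= D, forall h, nonexpansive h -> trunc_sum p eta l h <= S
      & S - eps <= trunc_sum p eta l f].
Proof.
move=> hD eps0; pose E := [set trunc_sum p eta l f | f in @nonexpansive R X].
have ubE : ubound E D by move=> _ [f nf <-]; exact: hD.
have E0 : E !=set0.
  by exists (trunc_sum p eta l (fun=> 0)); exists (fun=> 0) => //; exact: nonexpansive0.
have supE : has_sup E by split=> //; exists D.
have [_ [f nf <-] /ltW flt] := sup_adherent eps0 supE.
exists (sup E), f => //; split=> //; first exact: ge_sup.
by move=> h nh; apply: (sup_upper_bound supE); exists h.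
Qed.

(** The heart of the proof. [A t] is [max(|f x' - f x''|, eta)] for a nearly
    maximal [f]. A perturbation of [f] by [r g] and by [- r g] can raise the
    truncated sum by little more than the factor [1 + r]; summed over
    [r = 2^-k] with weights [2^(ks)] this is a bounded multiple of [D + e],
    because [s < 1]. By [dyadic_second_diff] the same sum of increments controls
    [sum_j w_j A_j^(p-s) |g x'_j - g x''_j|^s]. *)
Lemma truncated_weights_le p s l (D e : R) :
  0 < p -> p < s -> s < 1 -> close_exponents p s -> 0 < e ->
  (forall f, nonexpansive f ->
     \sum_(t <- l) `|t.1.1| * `|f t.1.2 - f t.2| `^ p <= D) ->
  exists A : R * X * X -> R,
    [/\ forall t, 0 < A t,
        \sum_(t <- l) `|t.1.1| * A t `^ p <= D + e
      & forall g, nonexpansive g ->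
        \sum_(t <- l) `|t.1.1| * A t `^ (p - s) * `|g t.1.2 - g t.2| `^ s <=
          ((2 `^ (s - p) - 1)^-1 + 3 * (2 / (2 - 2 `^ s)) + 2) * (D + e)].
Proof.
move=> p0 ps s1 close e0 hD.
have p1 : p <= 1 := ltW (lt_trans ps s1).
have a2 := powR2_lt s1.
have D0 : 0 <= D := le_trans (sum_powR_ge0 p _ l) (hD _ (@nonexpansive0 R X)).
pose La : R := \sum_(t <- l) `|t.1.1|.
have La0 : 0 <= La by apply: sumr_ge0.
have La1 : 0 < La + 1 by rewrite ltr_wpDl.
(* Truncating at [eta] raises the sum by at most [e]. *)
pose eta := (e / (La + 1)) `^ p^-1.
have eta0 : 0 < eta by rewrite powR_gt0 // divr_gt0.
have etap : La * eta `^ p <= e.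
  rewrite powRKV ?(ltW (divr_gt0 e0 La1)) // mulrCA ger_pMr //.
  by rewrite ler_pdivrMr // mul1r lerDl.
have hG f : nonexpansive f -> trunc_sum p eta l f <= D + e.
  move=> nf; apply: le_trans (lerD (hD f nf) etap).
  rewrite /La mulr_suml -big_split; apply: ler_sum => t _ /=.
  by rewrite -mulrDr ler_wpM2l // trunc_pow_le.
pose M : R := \sum_(t <- l) mdist t.1.2 t.2.
have M0 : 0 <= M by apply: sumr_ge0 => t _; exact: mdist_ge0.
(* The smallest step [2^-n] brings every difference of a nonexpansive function below [eta]. *)
pose n := Num.bound (M / eta).
have Mn : M <= 2 ^+ n * eta.
  rewrite -ler_pdivrMr //; apply: ltW; apply: lt_le_trans.
    by apply: archi_boundP; rewrite divr_ge0 // ltW.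
  by rewrite -natrX ler_nat ltnW // ltn_expl.
have dn (g : X -> R) t : nonexpansive g -> t \in l ->
    `|g t.1.2 - g t.2| <= 2 ^+ n * eta.
  move=> ng tl; apply: le_trans (ng _ _) _; apply: le_trans _ Mn.
  rewrite /M big_tnth; have [i ->] := seq_tnthP tl.
  rewrite (bigD1 i) //= lerDl; apply: sumr_ge0 => j _; exact: mdist_ge0.
pose W : R := \sum_(k < n.+1) (2 `^ s) ^+ k.
have W0 : 0 < W.
  rewrite /W big_ord_recl expr0 ltr_pwDl //.
  by apply: sumr_ge0 => k _; rewrite exprn_ge0 ?powR_ge0.
have De0 : 0 < D + e by rewrite ltr_wpDl.
(* The deviation of [f] from the supremum costs, over all steps, at most [D + e]. *)
have [S [f nf [SD hS fS]]] :=
  near_maximizer hG (divr_gt0 De0 (mulr_gt0 (ltr0n R 2) W0)).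
exists (fun t => Num.max `|f t.1.2 - f t.2| eta); split.
- by move=> t; rewrite lt_max eta0 orbT.
- exact: hG nf.
move=> g ng.
have nNg : nonexpansive (fun x => - g x).
  by move=> x y; rewrite -opprD normrN; exact: ng.
have S0 : 0 <= S := le_trans (trunc_sum_ge0 p eta l f) (hS f nf).
apply: le_trans (dyadic_second_diff f p0 ps s1 close eta0 (fun t => dn g t ng)) _.
set be := (2 `^ (s - p) - 1)^-1; set ka := 2 / (2 - 2 `^ s).
have be0 : 0 <= be by rewrite invr_ge0 subr_ge0 ltW // powR2_gt1 // subr_gt0.
have ka0 : 0 <= ka by rewrite divr_ge0 // subr_ge0 ltW.
have t1 : be * \sum_(t <- l) `|t.1.1| * `|g t.1.2 - g t.2| `^ p <= be * (D + e).
  by apply: ler_wpM2l => //; apply: le_trans (hD g ng) _; rewrite lerDl ltW.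
have t2 : (1 + ka) * trunc_sum p eta l f <= (1 + ka) * (D + e).
  by apply: ler_wpM2l; [rewrite addr_ge0|exact: hG].
have t3 : \sum_(k < n.+1) (2 `^ s) ^+ k *
       (trunc_sum p eta l (fun x => f x + (2 ^+ k)^-1 * g x)
        + trunc_sum p eta l (fun x => f x + (2 ^+ k)^-1 * - g x)
        - 2 * trunc_sum p eta l f) <= 2 * ka * (D + e) + (D + e).
  apply: le_trans (_ : \sum_(k < n.+1)
      (2 * S * (2 `^ s / 2) ^+ k + (D + e) / W * (2 `^ s) ^+ k) <= _).
    apply: ler_sum => k _.
    have k0 : 0 <= (2 ^+ k)^-1 :> R by rewrite invr_ge0 exprn_ge0.
    have q1 := trunc_sum_perturb (ltW p0) p1 eta0 k0 hS nf ng.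
    have q2 := trunc_sum_perturb (ltW p0) p1 eta0 k0 hS nf nNg.
    have -> : 2 * S * (2 `^ s / 2) ^+ k + (D + e) / W * (2 `^ s) ^+ k =
        (2 `^ s) ^+ k * (2 * S * (2 ^+ k)^-1 + (D + e) / W).
      by rewrite expr_div_n; ring.
    apply: ler_wpM2l; first by rewrite exprn_ge0 // powR_ge0.
    have : 2 * ((D + e) / (2 * W)) = (D + e) / W by field; rewrite gt_eqF.
    by move=> /second_diff_le; apply.
  rewrite big_split /= -!mulr_sumr -/W divfK ?gt_eqF // lerD2r.
  have q0 : 0 <= 2 `^ s / 2 :> R by rewrite divr_ge0 // powR_ge0.
  have q1 : 2 `^ s / 2 < 1 :> R by rewrite ltr_pdivrMr // mul1r.
  have := geometric_sum_le n.+1 q0 q1.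
  have -> : (1 - 2 `^ s / 2)^-1 = ka.
    by rewrite /ka; field; rewrite subr_eq0 gt_eqF.
  move=> /(ler_wpM2l (mulr_ge0 (ler0n R 2) S0)) /le_trans; apply.
  by rewrite mulrAC; apply: ler_wpM2l => //; rewrite mulr_ge0.
apply: le_trans (lerD (lerD t1 t2) t3) _.
have -> // : be * (D + e) + (1 + ka) * (D + e) + (2 * ka * (D + e) + (D + e)) =
  (be + 3 * ka + 2) * (D + e) by ring.
Qed.

(** Apply the [s]-summing property with the weights [w_j A_j^(p-s)] provided by
    [truncated_weights_le], and return to the exponent [p] by
    [d^p <= A^(p-s) d^s + A^p]. *)
Lemma summing_of_close p s T : 0 < p -> p < s -> s < 1 ->
  close_exponents p s -> summing s T -> summing p T.
Proof.
move=> p0 ps s1 close [C C0 hC].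
set K := (2 `^ (s - p) - 1)^-1 + 3 * (2 / (2 - 2 `^ s)) + 2.
have K0 : 0 <= K.
  rewrite !addr_ge0 // ?mulr_ge0 ?divr_ge0 // ?invr_ge0 subr_ge0 ltW //.
    by rewrite powR2_gt1 // subr_gt0.
  exact: powR2_lt.
have K1 : 0 < C * K + 1 by rewrite ltr_wpDl // mulr_ge0.
exists (C * K + 1); first exact: ltW.
move=> l D hD; apply/ler_addgt0Pr => e e0.
have e'0 := divr_gt0 e0 K1.
have [A [A0 sumA hA]] := truncated_weights_le p0 ps s1 close e'0 hD.
have -> : (C * K + 1) * D + e = (C * K + 1) * (D + e / (C * K + 1)).
  by rewrite [RHS]mulrDr [_ * (e / _)]mulrC divfK // gt_eqF.
set D' := D + _ in sumA hA *.
pose l' := [seq (`|t.1.1| * A t `^ (p - s), t.1.2, t.2) | t <- l].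
have wE (t : R * X * X) : `| `|t.1.1| * A t `^ (p - s)| = `|t.1.1| * A t `^ (p - s).
  by rewrite ger0_norm // mulr_ge0 ?powR_ge0.
have := hC l' (K * D'); rewrite big_map /=.
under eq_bigr do rewrite wE.
move=> H; have {}H : \sum_(t <- l) `|t.1.1| * A t `^ (p - s) *
    mdist (T t.1.2) (T t.2) `^ s <= C * (K * D').
  apply: H => f nf; rewrite big_map /=.
  by under eq_bigr do rewrite wE; exact: hA.
rewrite mulrDl mul1r -mulrA; apply: le_trans (lerD H sumA).
rewrite -big_split /=; apply: ler_sum => t _.
rewrite -mulrA -mulrDr; apply: ler_wpM2l => //.
have := weighted_young p0 ps (A0 t) ler01 (mdist_ge0 (T t.1.2) (T t.2)).
by rewrite !powR1 mul1r mulr1 addrC.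
Qed.

(** A step size for lowering the exponent that serves on all of [[p0, s0]]: there
    the left-hand side of [close_exponents] is at most
    [M = 3 + 2 / (2^p0 - 1) + 4 / (2 - 2^s0)], and [s - p <= c] with
    [2^c = 1 + 1/M] makes the right-hand side at least [M]. *)
Lemma close_exponents_uniform p0 s0 : 0 < p0 -> s0 < 1 ->
  exists2 c : R, 0 < c &
    forall p s, p0 <= p -> p < s -> s <= s0 -> s <= p + c -> close_exponents p s.
Proof.
move=> hp0 hs0.
have a1 : 1 < 2 `^ p0 :> R := powR2_gt1 hp0.
have a2 := powR2_lt hs0.
set M := 3 + 2 / (2 `^ p0 - 1) + 4 / (2 - 2 `^ s0).
have M0 : 0 < M by rewrite /M !addr_gt0 // divr_gt0 // subr_gt0.
have l2 : 0 < ln (2 : R) by rewrite ln_gt0 // ltr1n.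
have M1 : 1 < 1 + M^-1 by rewrite ltrDl invr_gt0.
exists (ln (1 + M^-1) / ln 2); first by rewrite divr_gt0 // ln_gt0.
move=> p s pp ps ss spc; rewrite /close_exponents.
have e1 : 2 `^ p0 <= 2 `^ s :> R by rewrite ler_powR ?ler1n // ltW // (le_lt_trans pp).
have e2 : 2 `^ s <= 2 `^ s0 :> R by rewrite ler_powR ?ler1n.
have sp1 : 1 < 2 `^ (s - p) :> R by rewrite powR2_gt1 // subr_gt0.
apply: le_trans (_ : M <= _).
  rewrite /M; apply: lerD; first (apply: lerD => //).
    by rewrite ler_wpM2l // lef_pV2 ?posrE ?subr_gt0 ?(lt_le_trans a1) // lerD2r.
  rewrite ler_wpM2l // lef_pV2 ?posrE ?subr_gt0 ?(le_lt_trans e2) //.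
  by rewrite lerD2l lerN2.
rewrite -[leLHS]invrK lef_pV2 ?posrE ?subr_gt0 ?invr_gt0 //.
rewrite lerBlDl /powR pnatr_eq0 /=.
rewrite -[leRHS]lnK ?posrE ?(lt_trans ltr01) // ler_expR.
by rewrite -ler_pdivlMr // lerBlDl.
Qed.

(** Goes from [s] down to [p] in finitely many steps between close exponents. *)
Lemma summing_ge p s T : 0 < p -> p < s -> s < 1 -> summing s T -> summing p T.
Proof.
move=> p0 ps s1.
have [c c0 hc] := close_exponents_uniform p0 s1.
have descend n : forall r, p < r -> r <= s -> r <= p + c *+ n ->
    summing r T -> summing p T.
  elim: n => [|n IH] r pr rs.
    by rewrite mulr0n addr0 leNgt pr.
  rewrite mulrSr addrA => hn hT; have r1 := le_lt_trans rs s1.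
  have [close|far] := leP r (p + c).
    by apply: summing_of_close hT => //; exact: hc.
  have pr' : p < r - c by rewrite ltrBrDr.
  apply: (IH (r - c)) => //.
  - by apply: le_trans rs; rewrite gerBl ltW.
  - by rewrite lerBlDr.
  apply: summing_of_close hT => //; first exact: lt_trans pr'.
    by rewrite gtrBl.
  by apply: hc; rewrite ?subrK ?gtrBl // ltW.
apply: (descend (Num.bound ((s - p) / c))) => //.
rewrite -lerBlDl -mulr_natl -ler_pdivrMr //; apply: ltW.
by apply: archi_boundP; rewrite divr_ge0 ?ltW // subr_gt0.
Qed.

End Extrapolation.

Theorem theorem6p4p3 (R : realType) (X Y : metricType R) (x0 : X) (y0 : Y)
    (p s : R) (hp : 0 < p) (hps : p < s) (hs : s < 1) :
  PiL X Y x0 p = PiL X Y x0 s.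
Proof.
have s0 := lt_trans hp hps.
apply/seteqP; split=> T /PiLP => /(_ _)[//|lipT sT]; apply/PiLP => //; split=> //.
  exact: summing_le sT.
exact: summing_ge sT.
Qed.
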